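(* The zonal polynomial coefficients satisfy, for integers $n$ in the indicated ranges, $$c_{(n-1,1),(n-1,1)}=\frac{2n(n-1)}{2n-1}\qquad(n\ge 2),$$ $$c_{(n-1,1),(n-2,2)}=\frac{2n(n-1)(n-2)}{(2n-1)(2n-5)}\qquad(n\ge 4),$$ $$c_{(n-2,2),(n-2,2)}=\frac{2n(n-1)(n-2)(n-3)}{(2n-3)(2n-5)}\qquad(n\ge 4).$$
   Context: Partitions: $\mathcal{P}_n$ is the set of integer partitions of $n$, i.e. tuples $\lambda=(\lambda_1,\ldots,\lambda_k)$ of integers with $\lambda_1\ge\cdots\ge\lambda_k\ge 1$ and $\lambda_1+\cdots+\lambda_k=n$. They are ordered lexicographically: $\kappa>\lambda$ iff for some $l$ one has $\kappa_1=\lambda_1,\ldots,\kappa_{l-1}=\lambda_{l-1}$ and $\kappa_l>\lambda_l$. Put $\rho_\lambda:=\sum_{i=1}^{k}\lambda_i(\lambda_i-i)$. Monomial symmetric functions: for $\lambda\in\mathcal{P}_n$ and variables $y_1,\ldots,y_q$, $M_\lambda(y_1,\ldots,y_q)$ is the sum of all distinct monomials obtained from $y_1^{\lambda_1}\cdots y_k^{\lambda_k}$ by permuting the variables (and $M_\lambda=0$ if $q<k$). Zonal polynomials and their coefficients: take $q\geq n$ variables $y_1,\dots,y_q$ (the coefficients do not depend on $q$). The zonal polynomials $\mathcal{C}_\kappa$, $\kappa\in\mathcal{P}_n$, are the symmetric homogeneous polynomials of degree $n$ of the form $\mathcal{C}_\kappa=\sum_{\lambda\le\kappa}c_{\kappa,\lambda}M_\lambda$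 (with $c_{\kappa,\lambda}=0$ for $\lambda<\kappa$ with $\rho_\kappa\le\rho_\lambda$) that are eigenfunctions $$\Delta_Y\,\mathcal{C}_\kappa=(\rho_\kappa+(q-1)n)\,\mathcal{C}_\kappa,\qquad \Delta_Y=\sum_{i=1}^{q}\Big(y_i^2\frac{\partial^2}{\partial y_i^2}+\sum_{j\ne i}\frac{y_i^2}{y_i-y_j}\frac{\partial}{\partial y_i}\Big),$$ normalized by $\sum_{\kappa\in\mathcal{P}_n}\mathcal{C}_\kappa=(y_1+\cdots+y_q)^n$. The numbers $c_{\kappa,\lambda}$ are the zonal polynomial coefficients (with $c_{\kappa,\lambda}=0$ for $\lambda>\kappa$). Equivalently, the $c_{\kappa,\lambda}$ are determined recursively as follows. For $\lambda<\kappa$ with $\rho_\kappa>\rho_\lambda$, $$c_{\kappa,\lambda}=\sum_{(r,s,t)}\frac{(\lambda_r+t)-(\lambda_s-t)}{\rho_\kappa-\rho_\lambda}\,c_{\kappa,\mu},$$ the sum being over all $r<s$ and $1\le t\le\lambda_s$ such that the partition $\mu$, obtained from $\lambda$ by replacing $\lambda_r$ by $\lambda_r+t$ and $\lambda_s$ by $\lambda_s-t$ and sorting in descending order (dropping zeros), satisfies $\lambda<\mu\le\kappa$. For $\lambda<\kappa$ with $\rho_\kappa\le\rho_\lambda$, $c_{\kappa,\lambda}=0$. The diagonal entries are determined by $\sum_{\kappa\ge\lambda}c_{\kappa,\lambda}=\frac{n!}{\lambda_1!\cdots\lambda_k!}$ for every $\lambda\in\mathcal{P}_n$; in particular $c_{(n),(n)}=1$.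 *)

(* Defs.v *)
From HB Require Import structures.
From mathcomp Require Export all_boot all_order all_algebra.
From mathcomp Require Export mpoly.

Set Implicit Arguments.
Unset Strict Implicit.
Unset Printing Implicit Defensive.

Import Order.TTheory GRing.Theory Num.Theory.
Local Open Scope ring_scope.

Definition is_partition (n : nat) (la : seq nat) : bool :=
  [&& sorted geq la, all (leq 1) la & sumn la == n].

(* A partition of n has at most n parts, each at most n. *)
Definition partitions (n : nat) : seq (seq nat) :=
  [seq la <- [seq map val (tval t) | k <- iota 0 n.+1, t <- enum {: k.-tuple 'I_n.+1}]
  | is_partition n la].

Lemma mem_partitions (n : nat) (la : seq nat) :
  (la \in partitions n) = is_partition n la.
Proof.
rewrite mem_filter; case: (boolP (is_partition n la)) => // /and3P[_ la_pos /eqP sla].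
rewrite andTb.
have le_n i : i \in la -> (i < n.+1)%N.
  by move=> ila; rewrite ltnS -sla sumnE (big_rem i) //= leq_addr.
have sz_la : (size la < n.+1)%N.
  rewrite ltnS -sla; elim: la la_pos {sla le_n} => //= i s IHs /andP[i_gt0 s_gt0].
  by rewrite -add1n leq_add // IHs.
apply/allpairsPdep; exists (size la).
exists (map_tuple (@inord n) (in_tuple la)); split.
- by rewrite mem_iota.
- by rewrite mem_enum.
rewrite /= -map_comp -[LHS]map_id; apply/eq_in_map => i ila /=.
by rewrite inordK // le_n.
Qed.

Lemma partitions_uniq (n : nat) : uniq (partitions n).
Proof.
apply/filter_uniq/allpairs_uniq_dep; first exact: iota_uniq.
  by move=> k _; apply: enum_uniq.
move=> [k1 t1] [k2 t2] _ _ /= eq_t.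
have ek : k1 = k2 by rewrite -(size_tuple t1) -(size_tuple t2) -(size_map val t1) eq_t size_map.
case: k2 / ek t2 eq_t => t2 /(inj_map val_inj) eq_t.
by congr existT; apply: val_inj.
Qed.

(* Lexicographic orders on partitions. The library's order on [seqlexi nat]
   also compares a sequence with its proper prefixes, but that case never
   arises between two partitions of the same integer. *)
Definition lex_lt (la ka : seq nat) : bool := (la < ka :> seqlexi nat)%O.
Definition lex_le (la ka : seq nat) : bool := (la <= ka :> seqlexi nat)%O.

(* The index i starts at 0 here, whence the shift by one. *)
Definition rho (la : seq nat) : int :=
  \sum_(i < size la) (nth 0%N la i)%:Z * ((nth 0%N la i)%:Z - i.+1%:Z).

Section Zonal.

Variables (R : realFieldType) (q : nat).
Implicit Types p : {mpoly R[q]}.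

(* Sum over the monomials whose exponent vector is a permutation of
   (la_1, ..., la_k, 0, ..., 0); there is none if q < k. The degree bound
   only makes the index type finite. *)
Definition monomial_symf (la : seq nat) : {mpoly R[q]} :=
  \sum_(m : 'X_{1..q < (sumn la).+1}
        | perm_eq (m : 'X_{1..q}) (la ++ nseq (q - size la) 0%N)) 'X_[m].

(* The operator has rational coefficients: its values are taken in the field
   of rational functions in y_1, ..., y_q. *)
Definition Delta p : {fraction {mpoly R[q]}} :=
  \sum_(i < q)
    (FracField.tofrac ('X_i ^+ 2 * p^`M(i)^`M(i)) +
     \sum_(j < q | j != i)
       FracField.tofrac ('X_i ^+ 2) / FracField.tofrac ('X_i - 'X_j)
       * FracField.tofrac p^`M(i)).

(* [C ka] is the zonal polynomial of the partition ka of n, in q variables,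
   and [c ka la] its coefficient at the monomial symmetric function of la.
   That each C ka is symmetric and homogeneous of degree n follows from the
   expansion. Nothing is required outside partitions of n. *)
Record zonal_system (n : nat) (C : seq nat -> {mpoly R[q]})
    (c : seq nat -> seq nat -> R) : Prop := ZonalSystem {
  zonal_expansion : forall ka, is_partition n ka ->
    C ka = \sum_(la <- partitions n | lex_le la ka) c ka la *: monomial_symf la;
  zonal_coef_rho : forall ka la, is_partition n ka -> is_partition n la ->
    lex_lt la ka -> rho ka <= rho la -> c ka la = 0;
  zonal_coef_above : forall ka la, is_partition n ka -> is_partition n la ->
    lex_lt ka la -> c ka la = 0;
  zonal_eigen : forall ka, is_partition n ka ->
    Delta (C ka) =
      (rho ka + (q%:Z - 1) * n%:Z)%:~R * FracField.tofrac (C ka);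
  zonal_norm : \sum_(ka <- partitions n) C ka = (\sum_(i < q) 'X_i) ^+ n
}.

End Zonal.

(* Main.v *)
Require Import Defs.
From mathcomp Require Import fingroup perm ring lra zify.

(** The eigenvalue equation is turned into linear relations between the
    coefficients of a zonal polynomial C_ka at monomials y_i^a y_j^b, and these
    are solved together with the normalization, which fixes the column sums
    of the matrix c.

    For a symmetric p, exchanging y_i and y_j turns y_i^2 dp/dy_i into
    y_j^2 dp/dy_j, so the difference of the two is divisible by y_i - y_j
    ([dvd_deriv_symmetric]). The two terms of the operator with denominators
    y_i - y_j and y_j - y_i therefore add up to a polynomial quotient E i j, and
    the eigenvalue equation becomes an identity between polynomials
    ([Delta_symmetric]). Comparing coefficients in
    (y_i - y_j) E = y_i^2 dp/dy_i - y_j^2 dp/dy_j relates E at a monomial to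
    E at the monomial where one factor y_j has been replaced by y_i. Iterating
    until y_j is exhausted gives the coefficients of E in closed form
    ([mcoeff_deriv_quotient]): this is where the weights
    (la_r + t) - (la_s - t) of the recurrence come from. At y_i^a y_j^b the
    eigenvalue equation then reads
    (rho_ka - rho_(a,b)) p_(a,b) = sum_(k = 1..b) (a - b + 2k) p_(a+k,b-k)
    ([two_part_recurrence]).

    The coefficient of C_ka at a monomial with exponents la is c ka la
    ([mcoeff_zonal]), and the coefficient of (y_1 + ... + y_q)^n at
    y_i^(n-b) y_j^b is the binomial n over b ([mcoeff_sumX_exp]). As (n), (n-1,1),
    (n-2,2) are the three largest partitions of n for n >= 4, their column sums
    have at most three terms ([zonal_column_sum]), and the unknowns are found one
    after the other:
    c_(n),(n) = 1 from the column sum 1; then c_(n),(n-1,1) = n/(2n-1) from the recurrence and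
    c_(n-1,1),(n-1,1) from the column sum n; then c_(n),(n-2,2) and
    c_(n-1,1),(n-2,2) from the recurrence and c_(n-2,2),(n-2,2) from the
    column sum n(n-1)/2. *)

Set Implicit Arguments.
Unset Strict Implicit.
Unset Printing Implicit Defensive.

Import Order.TTheory GRing.Theory Num.Theory.
Local Open Scope ring_scope.

(** * Coefficients of the divided differences of derivatives *)

Section Coefficients.
Variables (R : comNzRingType) (q : nat).
Implicit Types (p E : {mpoly R[q]}) (m : 'X_{1..q}) (i j : 'I_q).

Lemma mcoeffXM p i m : ('X_i * p)@_(m + U_(i)) = p@_m.
Proof. by rewrite -commr_mpolyX addmC mcoeffMX. Qed.

Lemma mcoeffXM0 p i m : m i = 0%N -> ('X_i * p)@_m = 0.
Proof.
move=> mi0; rewrite [p]mpolyE mulr_sumr raddf_sum /= big1 // => k _.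
rewrite -scalerAr -mpolyXD mcoeffZ mcoeffX; case: eqP => [mE | _]; last exact: mulr0.
by move: mi0; rewrite -mE mnmDE mnm1E eqxx.
Qed.

Lemma mnm_gt0_subU m i : (0 < m i)%N -> exists k, m = (k + U_(i))%MM.
Proof.
move=> mi_gt0; exists (m - U_(i))%MM; apply/mnmP => k.
by rewrite mnmDE mnmBE mnm1E; case: eqP => [<-|_]; lia.
Qed.

(** The truncated operations are harmless: for [m i] equal to 0 or 1 both sides
    vanish, since [(m i).-1] is 0. *)
Lemma mcoeff_sqrX_deriv p i m :
  ('X_i ^+ 2 * p^`M(i))@_m = p@_(m - U_(i)) *+ (m i).-1.
Proof.
rewrite expr2 -mulrA; have [mi0|] := posnP (m i).
  by rewrite mi0 mulr0n mcoeffXM0.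
case/mnm_gt0_subU=> k ->; rewrite mcoeffXM addmK mnmDE mnm1E eqxx addn1 /=.
have [ki0|] := posnP (k i); first by rewrite ki0 mulr0n mcoeffXM0.
by case/mnm_gt0_subU=> l ->; rewrite mcoeffXM mcoeff_deriv mnmDE mnm1E eqxx addn1.
Qed.

Lemma mcoeff_sqrX_deriv2 p i m :
  ('X_i ^+ 2 * p^`M(i)^`M(i))@_m = p@_m *+ (m i * (m i).-1).
Proof.
rewrite mcoeff_sqrX_deriv mcoeff_deriv; have [mi0|mi_gt0] := posnP (m i).
  by rewrite mi0 !mulr0n.
have -> : (m - U_(i) + U_(i))%MM = m.
  by case: (mnm_gt0_subU mi_gt0) => k ->; rewrite addmK.
by rewrite mnmBE mnm1E eqxx subn1 prednK // mulrnA.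
Qed.

Lemma mderiv_msym (s : 'S_q) p i : (msym s p)^`M(i) = msym s p^`M((s^-1)%g i).
Proof.
apply/mpolyP=> m; rewrite mcoeff_deriv !mcoeff_sym mcoeff_deriv mnmE permKV.
have -> // : [multinom (m + U_(i))%MM (s k) | k < q]
    = ([multinom m (s k) | k < q] + U_((s^-1)%g i))%MM.
by apply/mnmP => k; rewrite mnmE !mnmDE !mnmE (canF_eq (permK _)) invgK.
Qed.

Lemma msymXU (s : 'S_q) i : msym s 'X_i = 'X_(s i) :> {mpoly R[q]}.
Proof.
rewrite msymX; congr 'X_[_]; apply/mnmP => k.
by rewrite mnmE !mnm1E eq_sym (canF_eq (permKV s)) eq_sym.
Qed.

(** Write p' for the image of p under the transposition. The polynomials with
    this property form a subalgebra, because
    p1 p2 - p1' p2' = (p1 - p1') p2 + p1' (p2 - p2'), and it contains the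
    variables. *)
Lemma dvd_sub_msym_tperm i j p :
  exists E, p - msym (tperm i j) p = ('X_i - 'X_j) * E.
Proof.
pose D p := exists E, p - msym (tperm i j) p = ('X_i - 'X_j) * E.
have D1 : D 1 by exists 0; rewrite msym1 subrr mulr0.
have DM p1 p2 : D p1 -> D p2 -> D (p1 * p2).
  move=> [E1 D1'] [E2 D2]; exists (E1 * p2 + msym (tperm i j) p1 * E2).
  by rewrite msymM mulrDr mulrA -D1' mulrCA -D2; ring.
have DX k : D 'X_k.
  rewrite /D msymXU.
  case: tpermP => [->|->|_ _]; last by exists 0; rewrite subrr mulr0.
    by exists 1; rewrite mulr1.
  by exists (-1); rewrite mulrN1 opprB.
rewrite -/(D p) [p]mpolyE; elim/big_ind: _ => [|p1 p2 [E1 D1'] [E2 D2]|m _].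
- by exists 0; rewrite msym0 subrr mulr0.
- by exists (E1 + E2); rewrite msymD mulrDr -D1' -D2; ring.
suff [E DE] : D 'X_[m] by exists (p@_m *: E); rewrite msymZ -scalerBr DE -scalerAr.
have DXn k e : D ('X_k ^+ e).
  elim: e => [|e IHe]; first by rewrite expr0.
  by rewrite exprS; apply: DM => //; apply: DX.
by rewrite mpolyXE_id; apply: (big_ind D D1 DM) => k _; apply: DXn.
Qed.

(** For symmetric p the transposition of i and j sends [y_i^2 dp/dy_i] to
    [y_j^2 dp/dy_j], so the right-hand side is a polynomial minus its image under
    this transposition. *)
Lemma dvd_deriv_symmetric i j p : p \is symmetric ->
  exists E, ('X_i - 'X_j) * E = 'X_i ^+ 2 * p^`M(i) - 'X_j ^+ 2 * p^`M(j).
Proof.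
move=> /issymP p_sym.
have [E /esym DE] := dvd_sub_msym_tperm i j ('X_i ^+ 2 * p^`M(i)); exists E.
rewrite DE msymM rmorphXn /= msymXU tpermL; congr (_ - _ * _).
by rewrite -[in RHS](p_sym (tperm i j)) mderiv_msym tpermV tpermR.
Qed.

(** The coefficient at [n + U_(i) + U_(j)] of the equation satisfied by E
    expresses the coefficient of E at [n + U_(j)] by its coefficient at
    [n + U_(i)] and two coefficients of p. Since [m j = 0], moving the b factors
    y_j to y_i one at a time ends after b steps, and the sum telescopes into the
    weights [m i - b + 2 k]. *)
Lemma mcoeff_deriv_quotient p E i j m b : i != j -> m j = 0%N ->
  ('X_i - 'X_j) * E = 'X_i ^+ 2 * p^`M(i) - 'X_j ^+ 2 * p^`M(j) ->
  E@_(m + U_(j) *+ b) = p@_(m + U_(j) *+ b) *+ m i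
    + \sum_(1 <= k < b.+1)
        p@_(m + U_(i) *+ k + U_(j) *+ (b - k)) * ((m i)%:R - b%:R + 2 * k%:R).
Proof.
move=> ij + DE; elim: b m => [|b IHb] m mj0.
  rewrite big_geq // addr0 mulm0n addm0.
  have := congr1 (mcoeff (m + U_(i))%MM) DE.
  rewrite mulrBl !mcoeffB mcoeffXM mcoeffXM0 ?mnmDE ?mnm1E ?(negPf ij) ?mj0 //.
  rewrite !mcoeff_sqrX_deriv !mnmDE !mnm1E eqxx (negPf ij) mj0 addmK mulr0n !subr0.
  by rewrite addn1.
have := congr1 (mcoeff (m + U_(i) + U_(j) *+ b.+1)%MM) DE.
rewrite mulrBl !mcoeffB.
have -> : (m + U_(i) + U_(j) *+ b.+1 = m + U_(j) *+ b.+1 + U_(i))%MM.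
  by apply/mnmP=> l; rewrite !mnmDE; lia.
rewrite mcoeffXM mcoeff_sqrX_deriv addmK !mnmDE mulmnE !mnm1E eqxx.
rewrite (eq_sym j) (negPf ij) mul0n addn0 addn1 /=.
have -> : (m + U_(j) *+ b.+1 + U_(i) = m + U_(i) + U_(j) *+ b + U_(j))%MM.
  by apply/mnmP=> l; rewrite !(mnmDE, mulmnE); lia.
rewrite mcoeffXM mcoeff_sqrX_deriv addmK !mnmDE mulmnE !mnm1E eqxx.
rewrite (negPf ij) mj0 mul1n !add0n addn1 /=.
have miE : (m + U_(i))%MM i = (m i).+1 by rewrite mnmDE mnm1E eqxx addn1.
rewrite IHb ?miE; last by rewrite mnmDE mnm1E (negPf ij) mj0.
move/(canRL (subrK _)) => ->.
rewrite [in RHS]big_nat_recl // subn1 /= mulm1n.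
set S := (X in _ + (_ + X) = _); set S' := (X in _ = _ + (_ + X)).
have -> : S' = S.
  rewrite {}/S {}/S'; apply: eq_big_nat => k /andP[k_gt0 k_le].
  rewrite subSS mulmS addmA; congr (_ * _).
  by rewrite -![_.+1%:R]natr1; move: (m i)%:R b%:R k%:R => x y z; ring.
set x := p@_(_ + _ *+ b.+1); set y := p@_(_ + _ *+ b).
by move: S x y (m i) => s x y u; rewrite -!natr1; ring.
Qed.

End Coefficients.

(** * The eigenvalue equation in coefficients *)

Section Operator.
Variables (R : realFieldType) (q : nat).
Implicit Types (p : {mpoly R[q]}) (i j : 'I_q).

(** Two fractions with opposite denominators, as contributed by the pairs (i, j)
    and (j, i) to the operator. *)
Lemma mul_opposite_fractions (K : fieldType) (a u v w z : K) :
  a != 0 -> a * (u / a * v + w / (- a) * z) = u * v - w * z.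
Proof. by move=> a_neq0; rewrite invrN; field. Qed.

(** Doubling lets the sum run over ordered pairs (i, j): each unordered pair
    contributes the polynomial [E i j] once to the operator, and twice here, as
    [E i j] and [E j i]. *)
Lemma Delta_symmetric p : p \is symmetric ->
  exists2 E : 'I_q -> 'I_q -> {mpoly R[q]},
    forall i j,
      ('X_i - 'X_j) * E i j = 'X_i ^+ 2 * p^`M(i) - 'X_j ^+ 2 * p^`M(j)
  & Delta p *+ 2 =
      FracField.tofrac ((\sum_i 'X_i ^+ 2 * p^`M(i)^`M(i)) *+ 2
                        + \sum_i \sum_(j | j != i) E i j).
Proof.
move=> p_sym.
have /fin_all_exists[E DE] i := fin_all_exists (fun j => dvd_deriv_symmetric i j p_sym).
exists E => //; rewrite /Delta big_split /= mulrnDl rmorphD rmorphMn rmorph_sum /=.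
congr (_ + _); set F := fun i j => FracField.tofrac ('X_i ^+ 2) /
  FracField.tofrac ('X_i - 'X_j) * FracField.tofrac p^`M(i).
rewrite -[LHS]/((\sum_i \sum_(j | j != i) F i j) *+ 2) mulr2n.
rewrite [X in _ + X](exchange_big_dep xpredT) //= -big_split rmorph_sum /=.
apply: eq_bigr => i _; rewrite rmorph_sum /=.
under [X in _ + X]eq_bigl => j do rewrite eq_sym.
rewrite -big_split /=; apply: eq_bigr => j ji.
have Xij : FracField.tofrac ('X_i - 'X_j : {mpoly R[q]}) != 0.
  rewrite tofrac_eq0 subr_eq0; apply: contraNneq ji => /(congr1 (mcoeff U_(j))).
  rewrite !mcoeffXU eqxx eq_sym; case: (j == i) => // /eqP.
  by rewrite eq_sym oner_eq0.
rewrite /F -(opprB 'X_i 'X_j) rmorphN /=; apply: (mulfI Xij).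
rewrite mul_opposite_fractions // -!rmorphM DE rmorphB //.
Qed.

(** Away from the pair {i, j} the coefficient of [E k l] at y_i^a y_j^b is just
    (m_k + m_l) p_(a,b), since one of the variables y_k, y_l does not occur.
    Summed over all pairs these terms account for the part (q - 1)(a + b) of the
    eigenvalue; only the pair {i, j} couples p_(a,b) to other coefficients. *)
Lemma two_part_recurrence p (ev : R) (i j : 'I_q) (a b : nat) :
    i != j -> p \is symmetric -> Delta p = FracField.tofrac (ev *: p) ->
  (ev - (q%:R - 1) * (a + b)%:R - a%:R * (a%:R - 1) - b%:R * (b%:R - 2))
      * p@_(U_(i) *+ a + U_(j) *+ b)
    = \sum_(1 <= k < b.+1)
        p@_(U_(i) *+ (a + k) + U_(j) *+ (b - k)) * (a%:R - b%:R + 2 * k%:R).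
Proof.
move=> ij p_sym DeltaE; have [E DE Delta2] := Delta_symmetric p_sym.
set m := (_ + _)%MM; set S := (X in _ = X).
have ji : (j == i) = false by rewrite eq_sym (negPf ij).
have mE k : m k = ((k == i) * a + (k == j) * b)%N.
  by rewrite mnmDE !mulmnE !mnm1E (eq_sym i) (eq_sym j).
(* T is the excess of the pair {i, j} over the generic value (m_k + m_l) p_m. *)
pose T := S - p@_m *+ b.
have swapE k l : ('X_k - 'X_l) * E l k
    = 'X_k ^+ 2 * p^`M(k) - 'X_l ^+ 2 * p^`M(l).
  by rewrite -[LHS]opprK -mulNr opprB DE opprB.
have Eij F : ('X_i - 'X_j) * F = 'X_i ^+ 2 * p^`M(i) - 'X_j ^+ 2 * p^`M(j) ->
    F@_m = p@_m *+ (a + b) + T.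
  move=> FE; rewrite (mcoeff_deriv_quotient b ij _ FE) ?mulmnE ?mnm1E ?(negPf ij) //.
  rewrite /T mulrnDr addrACA subrr addr0 eqxx mul1n; congr (_ + _).
  apply: eq_bigr => k _; congr (_ * _).
  suff -> : (U_(i) *+ (a + k) = U_(i) *+ a + U_(i) *+ k)%MM by [].
  by apply/mnmP=> l; rewrite mnmDE !mulmnE mulnDr.
have E0 k l F : k != l -> m l = 0%N ->
    ('X_k - 'X_l) * F = 'X_k ^+ 2 * p^`M(k) - 'X_l ^+ 2 * p^`M(l) ->
    F@_m = p@_m *+ (m k + m l).
  move=> kl ml0 /(mcoeff_deriv_quotient 0 kl ml0).
  by rewrite mulm0n addm0 big_geq // addr0 ml0 addn0.
have Ecoef k l : l != k -> (E k l)@_m = p@_m *+ (m k + m l)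
    + ((k == i) && (l == j))%:R * T + ((k == j) && (l == i))%:R * T.
  move=> lk; have [/andP[/eqP -> /eqP ->]|nij] := boolP ((k == i) && (l == j)).
    rewrite (negPf ij) mul1r mul0r addr0 (Eij _ (DE _ _)).
    by rewrite !mE !eqxx ji (negPf ij) !mul0n !mul1n addn0.
  have [/andP[/eqP -> /eqP ->]|nji] := boolP ((k == j) && (l == i)).
    rewrite mul1r mul0r addr0 (Eij _ (swapE _ _)).
    by rewrite !mE !eqxx ji (negPf ij) !mul0n !mul1n addn0 add0n addnC.
  rewrite !mul0r !addr0.
  have [ml0|ml_neq0] := eqVneq (m l) 0%N; first by rewrite (E0 k l) // eq_sym.
  (* l is i or j, so k is neither of them. *)
  rewrite addnC (E0 l k) //.
  move: lk nij nji ml_neq0; rewrite !mE ![_ == k]eq_sym.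
  case: (l =P i) => [->|_]; first by rewrite andbT => /negPf-> _ /negPf->.
  case: (l =P j) => [->|_]; first by rewrite andbT => /negPf-> /negPf->.
  by rewrite !mul0n.
have sumE (f : 'I_q -> R) : (forall k, k != i -> k != j -> f k = 0) ->
    \sum_k f k = f i + f j.
  move=> f0; rewrite (bigD1 i) //= (bigD1 j) ?ji //= big1 ?addr0 //.
  by move=> k /andP[ki kj]; apply: f0.
have /eqP := Delta2; rewrite DeltaE -rmorphMn tofrac_eq => /eqP/(congr1 (mcoeff m)).
rewrite mcoeffMn mcoeffZ [in RHS]mcoeffD mcoeffMn !raddf_sum /=.
under eq_bigr do rewrite mcoeff_sqrX_deriv2.
rewrite sumE => [|k ki kj]; last by rewrite mE (negPf ki) (negPf kj).
pose mR k : R := (m k)%:R.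
have sum_mR : \sum_k mR k = a%:R + b%:R.
  rewrite sumE /mR ?mE ?eqxx ?ji ?(negPf ij) ?mul0n ?mul1n ?addn0 //.
  by move=> k ki kj; rewrite mE (negPf ki) (negPf kj).
have -> : \sum_k mcoeff m (\sum_(l | l != k) E k l)
    = p@_m * (2 * (q%:R - 1) * (a%:R + b%:R)) + 2 * T.
  transitivity (p@_m * (\sum_k \sum_(l | l != k) (mR k + mR l))
      + \sum_k \sum_(l | l != k) (((k == i) && (l == j))%:R * T
                                  + ((k == j) && (l == i))%:R * T)).
    rewrite mulr_sumr -big_split; apply: eq_bigr => k _ /=.
    rewrite raddf_sum mulr_sumr -big_split; apply: eq_bigr => l lk /=.
    by rewrite Ecoef // /mR -natrD mulr_natr addrA.
  congr (_ * _ + _).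
    under eq_bigr => k _.
      rewrite big_split /= sumr_const cardC1 card_ord.
      have -> : \sum_(l | l != k) mR l = a%:R + b%:R - mR k.
        by rewrite -sum_mR [in RHS](bigD1 k) //= addrAC subrr add0r.
      over.
    rewrite big_split /= sumrMnl sum_mR sumrB sumr_const card_ord sum_mR.
    have q1 : q.-1%:R = q%:R - 1 :> R.
      by rewrite -subn1 natrB // (leq_ltn_trans _ (ltn_ord i)).
    by rewrite -[_ *+ q.-1]mulr_natr -[_ *+ q]mulr_natr q1; ring.
  have sum_delta i' j' : j' != i' ->
      \sum_k \sum_(l | l != k) ((k == i') && (l == j'))%:R * T = T.
    move=> ji'; rewrite (bigD1 i') //= (bigD1 j') //= !eqxx mul1r.
    rewrite !big1 ?addr0 // => [k /negPf ki|l /andP[_ /negPf lj]].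
      by apply: big1 => l _; rewrite ki mul0r.
    by rewrite lj mul0r.
  under eq_bigr do rewrite big_split.
  by rewrite big_split /= !sum_delta ?ji // mulr_natl mulr2n.
rewrite !mE !eqxx ji (negPf ij) !mul0n !mul1n add0n addn0 /T {Eij Ecoef T}.
have predM (c : nat) : (c * c.-1)%:R = c%:R * (c%:R - 1) :> R.
  by case: c => [|c]; rewrite ?mul0r // natrM -natr1 addrK.
rewrite -!(mulr_natr p@_m) !predM natrD.
by move: S p@_m => S x H; lra.
Qed.
End Operator.

(** * Coefficients of powers of the sum of the variables *)

Section Power.
Variables (R : numDomainType) (q : nat).

Lemma mderiv_sumX_exp j n :
  ((\sum_(i < q) 'X_i : {mpoly R[q]}) ^+ n.+1)^`M(j) = (\sum_(i < q) 'X_i) ^+ n *+ n.+1.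
Proof.
have dX : (\sum_(i < q) 'X_i : {mpoly R[q]})^`M(j) = 1.
  rewrite raddf_sum (bigD1 j) //= big1 => [|i ij]; rewrite mderivX mnm1E ?eqxx.
    have -> : (U_(j) - U_(j) = 0)%MM by apply/mnmP=> k; rewrite mnmBE subnn mnm0E.
    by rewrite addr0 mpolyX0 scale1r.
  by rewrite (negPf ij) scale0r.
elim: n => [|n IHn]; first by rewrite expr1 dX.
by rewrite exprS mderivM dX IHn mul1r mulrnAr -exprS -mulrS.
Qed.

(** Differentiating the power with respect to one variable lowers the exponent
    of that variable, which yields the recursion k C(n, k) = n C(n - 1, k - 1). *)
Lemma mcoeff_sumX_exp (i j : 'I_q) (a b : nat) : i != j ->
  ((\sum_(k < q) 'X_k : {mpoly R[q]}) ^+ (a + b))@_(U_(i) *+ a + U_(j) *+ b)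
    = 'C(a + b, b)%:R.
Proof.
move=> ij.
have stepE k m n : ((\sum_(k < q) 'X_k : {mpoly R[q]}) ^+ n.+1)@_(m + U_(k))
      *+ (m k).+1 = ((\sum_(k < q) 'X_k : {mpoly R[q]}) ^+ n)@_m *+ n.+1.
  by rewrite -mcoeff_deriv mderiv_sumX_exp mcoeffMn.
elim: b => [|b IHb].
  rewrite mulm0n addm0 addn0 bin0; elim: a => [|a IHa].
    by rewrite mulm0n expr0 mcoeff1 eqxx.
  have := stepE i (U_(i) *+ a)%MM a; rewrite -mulmSr IHa mulmnE mnm1E eqxx mul1n.
  by move/(pmulrnI (ltn0Sn a)).
have := stepE j (U_(i) *+ a + U_(j) *+ b)%MM (a + b)%N.
rewrite -addmA -mulmSr IHb mnmDE !mulmnE !mnm1E eqxx (negPf ij) mul0n mul1n add0n.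
rewrite -mulrnA mulnC mul_bin_diag mulnC mulrnA addnS.
by move/(pmulrnI (ltn0Sn b)).
Qed.

End Power.

(** * Zonal coefficients as coefficients of polynomials *)

(** A partition is recovered from its padding by zeros as the decreasing list of
    the nonzero entries. *)
Lemma perm_part_nseq0 n la mu k l : is_partition n la -> is_partition n mu ->
  perm_eq (la ++ nseq k 0%N) (mu ++ nseq l 0%N) -> la = mu.
Proof.
move=> /and3P[la_dec la_pos _] /and3P[mu_dec mu_pos _].
move/(perm_filter (leq 1)); rewrite !filter_cat (all_filterP la_pos) (all_filterP mu_pos).
rewrite !filter_nseq !cats0; apply: (@sorted_eq _ geq) => //.
  by move=> y x z yx zy; apply: leq_trans zy yx.
by move=> x y /andP[xy yx]; apply/eqP; rewrite eqn_leq; apply/andP; split.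
Qed.

Lemma sum_supp_seq (V : nmodType) (T : eqType) (r s : seq T) (F : T -> V) :
  uniq r -> uniq s -> {subset s <= r} -> {in r, forall x, x \notin s -> F x = 0} ->
  \sum_(x <- r) F x = \sum_(x <- s) F x.
Proof.
move=> r_uniq s_uniq s_r F0; rewrite (bigID (mem s)) /= [X in _ + X]big_seq_cond.
rewrite [X in _ + X]big1 => [|x /andP[]]; last exact: F0.
rewrite addr0 -big_filter; apply: perm_big; apply: uniq_perm => //.
  exact: filter_uniq.
by move=> x; rewrite mem_filter andb_idr // => /s_r.
Qed.

Section ZonalCoef.
Variables (R : realFieldType) (q : nat).

Lemma mcoeff_monomial_symf (la : seq nat) (m : 'X_{1..q}) :
  (monomial_symf R q la)@_m = (perm_eq m (la ++ nseq (q - size la) 0%N))%:R.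
Proof.
rewrite /monomial_symf raddf_sum /=; under eq_bigr do rewrite mcoeffX.
have [m_la|m_la] := boolP (perm_eq m _); last first.
  by rewrite big1 // => m' m'_la; case: eqP => // m'm; rewrite -m'm m'_la in m_la.
have dm : (mdeg m < (sumn la).+1)%N.
  by rewrite ltnS /mdeg -sumnE (perm_sumn m_la) sumn_cat sumn_nseq mul0n addn0.
rewrite (bigD1 (BMultinom dm)) //= eqxx big1 ?addr0 // => m' /andP[_ m'm].
by rewrite -val_eqE /= in m'm; rewrite (negPf m'm).
Qed.

Lemma monomial_symf_sym la : monomial_symf R q la \is symmetric.
Proof.
apply/issymP=> s; apply/mpolyP=> m; rewrite mcoeff_sym !mcoeff_monomial_symf.
suff /permPl -> : perm_eq [multinom m (s i) | i < q] m by [].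
by apply/tuple_permP; exists s.
Qed.

Variables (n : nat) (C : seq nat -> {mpoly R[q]}) (c : seq nat -> seq nat -> R).
Hypothesis hC : zonal_system n C c.

Lemma zonal_symmetric ka : is_partition n ka -> C ka \is symmetric.
Proof.
move=> ka_n; rewrite (zonal_expansion hC ka_n); apply: rpred_sum => la _.
exact/rpredZ/monomial_symf_sym.
Qed.

(** A monomial whose exponents form la occurs in the monomial function of la and
    in no other. If la > ka, this function is absent from the expansion of [C ka],
    in accordance with [c ka la = 0]. *)
Lemma mcoeff_zonal ka la (m : 'X_{1..q}) :
    is_partition n ka -> is_partition n la ->
  perm_eq m (la ++ nseq (q - size la) 0%N) -> (C ka)@_m = c ka la.
Proof.
move=> ka_n la_n m_la; rewrite (zonal_expansion hC ka_n) raddf_sum /=.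
under eq_bigr do rewrite mcoeffZ mcoeff_monomial_symf.
rewrite big_mkcond (bigD1_seq la) ?mem_partitions ?partitions_uniq //= m_la mulr1.
rewrite big_seq_cond big1 => [|mu /andP[mu_n mu_la]]; last first.
  case: ifP => // _; case: (boolP (perm_eq m _)) => [|_]; last by rewrite mulr0.
  move=> m_mu; case/eqP: mu_la; rewrite mem_partitions in mu_n.
  by apply: (perm_part_nseq0 mu_n la_n); apply: perm_trans m_la; rewrite perm_sym; exact: m_mu.
rewrite addr0; case: (boolP (lex_le la ka)) => [//|].
by rewrite /lex_le -Order.TotalTheory.ltNge => /(zonal_coef_above hC ka_n la_n).
Qed.

Lemma zonal_norm_coef la (m : 'X_{1..q}) : is_partition n la ->
  perm_eq m (la ++ nseq (q - size la) 0%N) ->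
  \sum_(ka <- partitions n) c ka la = ((\sum_(i < q) 'X_i : {mpoly R[q]}) ^+ n)@_m.
Proof.
move=> la_n m_la; rewrite -(zonal_norm hC) raddf_sum /= !big_seq.
by apply: eq_bigr => ka; rewrite mem_partitions => ka_n; rewrite (mcoeff_zonal ka_n la_n m_la).
Qed.
End ZonalCoef.

(** * Monomials and partitions with at most two parts *)

Lemma perm_two_part_mnm q (i j : 'I_q) a b : i != j ->
  perm_eq (U_(i) *+ a + U_(j) *+ b)%MM ([:: a; b] ++ nseq (q - 2) 0%N).
Proof.
move=> ij; set m := (_ + _)%MM.
have mE k : m k = ((i == k) * a + (j == k) * b)%N.
  by rewrite mnmDE !mulmnE !mnm1E.
have -> : m = [seq m k | k <- enum 'I_q] :> seq nat by rewrite -map_tnth_enum.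
pose s := rem j (rem i (enum 'I_q)).
have enum_ij : perm_eq (enum 'I_q) [:: i, j & s].
  apply: perm_trans (perm_to_rem (mem_enum _ i)) _.
  by rewrite perm_cons perm_to_rem // mem_rem_uniq ?enum_uniq // !inE eq_sym ij mem_enum.
apply: perm_trans (perm_map m enum_ij) _; rewrite /= !mE !eqxx (negPf ij) eq_sym (negPf ij).
rewrite !mul0n !mul1n addn0 add0n !perm_cons.
have sz_s : size s = (q - 2)%N.
  by have := perm_size enum_ij; rewrite size_enum_ord /=; lia.
rewrite -sz_s -(size_map m); set z := map m s.
suff /all_pred1P <- : all (pred1 0%N) z by exact: perm_refl.
apply/allP=> _ /mapP[k ks ->] /=.
have : uniq [:: i, j & s] by rewrite -(perm_uniq enum_ij) enum_uniq.
rewrite /= inE negb_or => /and3P[/andP[_ is_] js _].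
rewrite mE; case: (i =P k) => [ik|_]; first by rewrite ik ks in is_.
by case: (j =P k) => [jk|_]; first by rewrite jk ks in js.
Qed.

Lemma perm_one_part_mnm q (i j : 'I_q) a : i != j ->
  perm_eq (U_(i) *+ a + U_(j) *+ 0)%MM ([:: a] ++ nseq (q - 1) 0%N).
Proof.
move=> ij; have -> : (q - 1 = (q - 2).+1)%N.
  by have := ltn_ord i; have := ltn_ord j; move: ij; rewrite -val_eqE /=; lia.
exact: perm_two_part_mnm a 0 ij.
Qed.

Lemma rho1 a : rho [:: a] = a%:Z * (a%:Z - 1).
Proof. by rewrite /rho big_ord_recl big_ord0 addr0. Qed.

Lemma rho2 a b : rho [:: a; b] = a%:Z * (a%:Z - 1) + b%:Z * (b%:Z - 2).
Proof. by rewrite /rho !big_ord_recl big_ord0 addr0. Qed.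

Lemma lex_ltE a b s t :
  lex_lt (a :: s) (b :: t) = (a < b)%N || (a == b) && lex_lt s t.
Proof.
by rewrite /lex_lt [LHS]ltxi_cons !leEnat; case: ltngtP.
Qed.

Lemma is_partition2 n k : (0 < k)%N -> (k <= n - k)%N ->
  is_partition n [:: (n - k)%N; k].
Proof. by move=> k_gt0 k_le; apply/and3P; split=> /=; lia. Qed.

Lemma partition_top1 n ka : (0 < n)%N -> is_partition n ka ->
  ka \notin [:: [:: n]] -> lex_lt ka [:: n].
Proof.
case: ka => [|a ka] n_gt0 /and3P[ka_dec ka_pos /eqP /= ka_sum].
  by rewrite -ka_sum in n_gt0.
rewrite !inE lex_ltE => not_n.
case: (ltngtP a n) => //= [|a_n]; first by lia.
move: not_n; case: ka ka_dec ka_pos ka_sum => [|b ka] /=; rewrite a_n ?eqxx //.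
lia.
Qed.

Lemma partition_top2 n ka : (2 <= n)%N -> is_partition n ka ->
  ka \notin [:: [:: n]; [:: (n - 1)%N; 1%N]] -> lex_lt ka [:: (n - 1)%N; 1%N].
Proof.
case: ka => [|a [|b [|d ka]]] n_ge2 /and3P[/= ka_dec ka_pos /eqP /= ka_sum].
- by rewrite -ka_sum in n_ge2.
- by rewrite !inE -ka_sum addn0 eqxx.
- rewrite !inE !eqseq_cons !andbT !lex_ltE /=; lia.
- by rewrite lex_ltE; lia.
Qed.

Lemma partition_top3 n ka : (4 <= n)%N -> is_partition n ka ->
  ka \notin [:: [:: n]; [:: (n - 1)%N; 1%N]; [:: (n - 2)%N; 2%N]] ->
  lex_lt ka [:: (n - 2)%N; 2%N].
Proof.
case: ka => [|a [|b [|d ka]]] n_ge4 /and3P[/= ka_dec ka_pos /eqP /= ka_sum].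
- by rewrite -ka_sum in n_ge4.
- by rewrite !inE -ka_sum addn0 eqxx.
- rewrite !inE !eqseq_cons !andbT !lex_ltE /=; lia.
- rewrite !lex_ltE; lia.
Qed.

(** * Column sums and the two-part recurrence *)

Section Values.
Variables (R : realFieldType) (n q : nat).
Variables (C : seq nat -> {mpoly R[q]}) (c : seq nat -> seq nat -> R).
Hypothesis hC : zonal_system n C c.
Variables i j : 'I_q.
Hypothesis ij : i != j.

(** The part (q - 1) n of the eigenvalue cancels, so the relation does not depend
    on the number of variables. *)
Lemma zonal_two_part_recurrence ka b : is_partition n ka -> (b <= n)%N ->
  ((rho ka)%:~R - (n - b)%:R * ((n - b)%:R - 1) - b%:R * (b%:R - 2))
      * (C ka)@_(U_(i) *+ (n - b) + U_(j) *+ b)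
    = \sum_(1 <= k < b.+1)
        (C ka)@_(U_(i) *+ (n - (b - k)) + U_(j) *+ (b - k))
          * (n%:R - 2 * b%:R + 2 * k%:R).
Proof.
move=> ka_n b_le.
have DeltaC : Delta (C ka)
    = FracField.tofrac (((rho ka + (q%:Z - 1) * n%:Z)%:~R : R) *: C ka).
  by rewrite (zonal_eigen hC ka_n) -mul_mpolyC rmorphM /= !rmorph_int.
have := two_part_recurrence (n - b) b ij (zonal_symmetric hC ka_n) DeltaC.
rewrite subnK // rmorphD rmorphM rmorphB /= addrK => ->.
rewrite !big_seq; apply: eq_bigr => k; rewrite mem_index_iota => /andP[k_gt0 k_le].
have -> : (n - b + k)%N = (n - (b - k))%N by lia.
by rewrite natrB //; congr (_ * _); ring.
Qed.

(** The hypothesis on the partitions outside of s says that s contains every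
    ka >= la, hence the whole support of the column of la. *)
Lemma zonal_column_sum la s (b : nat) :
    is_partition n la -> (b <= n)%N ->
    perm_eq (U_(i) *+ (n - b) + U_(j) *+ b)%MM (la ++ nseq (q - size la) 0%N) ->
    all (is_partition n) s -> uniq s ->
    (forall ka, is_partition n ka -> ka \notin s -> lex_lt ka la) ->
  \sum_(ka <- s) c ka la = 'C(n, b)%:R.
Proof.
move=> la_n b_le m_la /allP s_n s_uniq above.
have := mcoeff_sumX_exp R (n - b) b ij; rewrite subnK // => <-.
rewrite -(zonal_norm_coef hC la_n m_la); apply/esym/sum_supp_seq => //.
- exact: partitions_uniq.
- by move=> ka /s_n; rewrite mem_partitions.
move=> ka; rewrite mem_partitions => ka_n ka_s.
exact: (zonal_coef_above hC ka_n la_n (above _ ka_n ka_s)).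
Qed.

End Values.

Theorem theorem5p2 (R : realFieldType) (n q : nat) (hq : (n <= q)%N)
    (C : seq nat -> {mpoly R[q]}) (c : seq nat -> seq nat -> R)
    (hC : zonal_system n C c) :
  [/\ (2 <= n)%N ->
        c [:: (n - 1)%N; 1%N] [:: (n - 1)%N; 1%N] =
          2 * n%:R * (n%:R - 1) / (2 * n%:R - 1),
      (4 <= n)%N ->
        c [:: (n - 1)%N; 1%N] [:: (n - 2)%N; 2%N] =
          2 * n%:R * (n%:R - 1) * (n%:R - 2)
          / ((2 * n%:R - 1) * (2 * n%:R - 5))
    & (4 <= n)%N ->
        c [:: (n - 2)%N; 2%N] [:: (n - 2)%N; 2%N] =
          2 * n%:R * (n%:R - 1) * (n%:R - 2) * (n%:R - 3)
          / ((2 * n%:R - 3) * (2 * n%:R - 5))].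
Proof.
have [n_lt2|n_ge2] := ltnP n 2; first by split=> ?; lia.
have q_gt0 : (0 < q)%N by lia.
have q_gt1 : (1 < q)%N by lia.
pose i := Ordinal q_gt0; pose j := Ordinal q_gt1.
have ij : i != j by [].
pose k0 := [:: n]; pose k1 := [:: (n - 1)%N; 1%N]; pose k2 := [:: (n - 2)%N; 2%N].
have k0_n : is_partition n k0.
  by rewrite /is_partition /= addn0 eqxx !andbT; lia.
have k1_n : is_partition n k1 by apply: is_partition2; lia.
have n1 : (n - 1)%:R = n%:R - 1 :> R by rewrite natrB //; lia.
have n2 : (n - 2)%:R = n%:R - 2 :> R by rewrite natrB.
have ge2 : 2 <= n%:R :> R by rewrite ler_nat.
have perm0 := perm_one_part_mnm n ij.
have perm1 := perm_two_part_mnm (n - 1) 1 ij.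
have perm2 := perm_two_part_mnm (n - 2) 2 ij.
have c00 : c k0 k0 = 1.
  have := zonal_column_sum (b := 0) hC ij (s := [:: k0]) k0_n.
  rewrite subn0 bin0 big_seq1; apply=> //=; first by rewrite k0_n.
  by move=> ka; apply: partition_top1; lia.
have c10 : c k1 k0 = 0.
  by apply: (zonal_coef_above hC); rewrite // lex_ltE; lia.
have n0 : n%:~R = n%:R :> R by rewrite pmulrn.
have c01 : (2 * n%:R - 1) * c k0 k1 = n%:R.
  have := zonal_two_part_recurrence (b := 1) hC ij k0_n; rewrite big_nat1 subnn subn0.
  rewrite (mcoeff_zonal hC k0_n k1_n perm1) (mcoeff_zonal hC k0_n k0_n perm0) c00.
  rewrite rho1 rmorphM rmorphB /= n0 n1 => H.
  by have := H ltac:(lia); lra.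
have sum1 : c k0 k1 + c k1 k1 = n%:R.
  have := zonal_column_sum (b := 1) hC ij (s := [:: k0; k1]) k1_n.
  rewrite !big_cons big_nil addr0 bin1; apply=> //=; rewrite ?k0_n ?k1_n //.
  - by lia.
  - rewrite inE eqseq_cons andbF //.
  - by move=> ka; apply: partition_top2.
have d1 : 2 * n%:R - 1 != 0 :> R by apply/lt0r_neq0; lra.
have c01E : c k0 k1 = n%:R / (2 * n%:R - 1).
  by apply: (mulfI d1); rewrite c01 mulrCA divff ?mulr1.
have c11 : c k1 k1 = 2 * n%:R * (n%:R - 1) / (2 * n%:R - 1).
  rewrite -[LHS](addKr (c k0 k1)) sum1 c01E; field; exact: d1.
have [n_lt4|n_ge4] := ltnP n 4; first by split=> // ?; lia.
have ge4 : 4 <= n%:R :> R by rewrite ler_nat.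
have d3 : 2 * n%:R - 3 != 0 :> R by apply/lt0r_neq0; lra.
have d5 : 2 * n%:R - 5 != 0 :> R by apply/lt0r_neq0; lra.
have k2_n : is_partition n k2 by apply: is_partition2; rewrite ?(leq_sub2r 2 n_ge4).
have rec2 ka : is_partition n ka ->
    ((rho ka)%:~R - (n%:R - 2) * (n%:R - 3)) * c ka k2
      = (n%:R - 2) * c ka k1 + n%:R * c ka k0.
  move=> ka_n; have := zonal_two_part_recurrence (b := 2) hC ij ka_n n_ge2.
  rewrite big_nat_recl // big_nat1 subnn subn0.
  rewrite (mcoeff_zonal hC ka_n k2_n perm2) (mcoeff_zonal hC ka_n k1_n perm1).
  by rewrite (mcoeff_zonal hC ka_n k0_n perm0) n2; lra.
have c12 : c k1 k2
    = 2 * n%:R * (n%:R - 1) * (n%:R - 2) / ((2 * n%:R - 1) * (2 * n%:R - 5)).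
  have rhoE : (rho k1)%:~R - (n%:R - 2) * (n%:R - 3) = 2 * n%:R - 5 :> R.
    by rewrite rho2 rmorphD !rmorphM !rmorphB /= -pmulrn n1; ring.
  apply: (mulfI d5); rewrite -{1}rhoE rec2 // c10 c11; field.
  by rewrite d1 d5.
have c02 : c k0 k2 = n%:R * (3 * n%:R - 3) / ((2 * n%:R - 1) * (4 * n%:R - 6)).
  have d6 : 4 * n%:R - 6 != 0 :> R by apply/lt0r_neq0; lra.
  have rhoE : (rho k0)%:~R - (n%:R - 2) * (n%:R - 3) = 4 * n%:R - 6 :> R.
    by rewrite rho1 rmorphM rmorphB /= -pmulrn; ring.
  apply: (mulfI d6); rewrite -{1}rhoE rec2 // c00 c01E; field.
  by rewrite d1 d6.
have sum2 : c k0 k2 + (c k1 k2 + c k2 k2) = n%:R * (n%:R - 1) / 2.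
  have bin2R : 'C(n, 2)%:R = n%:R * (n%:R - 1) / 2 :> R.
    have := mul_bin_diag n 1; rewrite bin1 => /(congr1 (fun k => k%:R : R)).
    rewrite !natrM -subn1 n1; lra.
  have := zonal_column_sum (b := 2) hC ij (s := [:: k0; k1; k2]) k2_n.
  rewrite !big_cons big_nil addr0 bin2R; apply=> //=; rewrite ?k0_n ?k1_n ?k2_n //.
  - by rewrite !inE !eqseq_cons /= !andbF.
  - by move=> ka; apply: partition_top3.
split=> // _.
have -> : c k2 k2 = n%:R * (n%:R - 1) / 2 - c k0 k2 - c k1 k2 by rewrite -sum2; ring.
have d6 : 4 * n%:R - 6 != 0 :> R by apply/lt0r_neq0; lra.
by rewrite c02 c12; field; rewrite d1 d3 d5 d6.
Qed.
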